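(* Let $E\subset\mathbb{R}^2$ be a connected polygonal region and let $p\in\partial E$ be a point of its boundary. If $p$ is a convex vertex of $E$, then there is an open neighborhood $\mathcal{N}(p)$ of $p$ in $E$ which contains no convex vertex of $E$ other than $p$ and for which $$p=\operatorname*{arg\,max}_{q\in\mathcal{N}(p)}\tau(q),$$ i.e. $p$ is the maximizer of the tightness measure $\tau$ over $\mathcal{N}(p)$: $\tau(q)<\tau(p)$ for all $q\in\mathcal{N}(p)\setminus\{p\}$.
   Context: A connected polygonal region $E\subset\mathbb{R}^2$ is a compact connected set with nonempty interior which is the closure of its interior and whose boundary $\partial E$ consists of finitely many pairwise disjoint simple closed polygons. Each boundary point $q\in\partial E$ has an interior angle $\theta_q\in(0,2\pi)$ of $E$ at $q$: $\theta_q=\pi$ if $q$ lies in the relative interior of an edge, and at vertices $\theta_q\neq\pi$. A vertex $q$ is convex if $\theta_q<\pi$ and concave if $\theta_q>\pi$. Neighborhoods are open relative to $E$. The tightness measure $\tau:E\to[0,\pi)$ is the spanning angle of the (local) normal cone of $E$ at a point, that is, the angular size of the set of directions $d$ such that $d^Tq\ge d^Tx$ for all $x\in E$ sufficiently close to $q$. Explicitly: $\tau(q)=\pi-\theta_q$ if $q\in\partial E$ and $\theta_q\le\pi$ (so $\tau(q)=0$ in the relative interior of an edge); $\tau(q)=0$ if $q$ is a concave vertex; and $\tau(q)=0$ if $q$ is an interior point of $E$. *)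

(* Defs.v *)
From HB Require Import structures.
From mathcomp Require Import all_boot all_order all_algebra.
From mathcomp Require Import all_classical all_reals all_analysis.

Set Implicit Arguments.
Unset Strict Implicit.
Unset Printing Implicit Defensive.

Import Order.TTheory GRing.Theory Num.Theory.
Import numFieldNormedType.Exports.

Local Open Scope classical_set_scope.
Local Open Scope ring_scope.

Section PolygonalRegions.
Context {R : realType}.

Local Notation point := (R * R)%type.
Implicit Types (E : set point) (a b c d p q x : point) (s : seq point).

Definition dot d x : R := d.1 * x.1 + d.2 * x.2.

Definition cross d x : R := d.1 * x.2 - d.2 * x.1.

Definition segment a b : set point :=
  [set x | exists2 t : R, 0 <= t <= 1 & x = (1 - t) *: a + t *: b].

(* A closed polygon is the cyclic list of its vertices; indices are read
   modulo its length. *)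
Definition vert s (i : nat) : point := nth 0 s (i %% size s).

Definition edge s (i : nat) : set point := segment (vert s i) (vert s i.+1).

Definition polygon s : set point := \bigcup_(i in `I_(size s)) edge s i.

(* Two distinct edges may only meet when they are cyclically consecutive, and
   then only at the vertex they share. The last clause says that the listed
   vertices are genuine corners: no three consecutive ones are collinear. *)
Definition simple_closed_polygon s : Prop :=
  [/\ (3 <= size s)%N,
      uniq s,
      forall (i j : nat) x,
        (i < size s)%N -> (j < size s)%N -> i <> j ->
        edge s i x -> edge s j x ->
        (j = (i.+1 %% size s)%N /\ x = vert s j) \/
        (i = (j.+1 %% size s)%N /\ x = vert s i)
    & forall i : nat,
        cross (vert s i.+1 - vert s i) (vert s i.+2 - vert s i.+1) != 0].

Definition frontier E : set point := closure E `\` interior E.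

Definition boundary_polygons E (P : set (seq point)) : Prop :=
  [/\ finite_set P,
      forall s, P s -> simple_closed_polygon s,
      trivIset P polygon
    & frontier E = \bigcup_(s in P) polygon s].

Definition connected_polygonal_region E : Prop :=
  [/\ compact E,
      connected E,
      interior E !=set0,
      closure (interior E) = E
    & exists P, boundary_polygons E P].

(* Since the polygons in [P] have no straight corners, this does not depend on
   the choice of [P]. *)
Definition vertex E q : Prop :=
  exists P, boundary_polygons E P /\ exists2 s, P s & q \in s.

(* Angle (in radians) spanned by the directions belonging to [C]. *)
Definition angular_size (C : set point) : R :=
  fine (lebesgue_measure
    [set phi : R | 0 <= phi < 2 * pi /\ C (cos phi, sin phi)]).

(* Directions along which one can leave [q] while staying in [E]. *)
Definition feasible_cone E q : set point :=
  [set d | \forall t \near 0^'+, E (q + t *: d)].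

Definition interior_angle E q : R := angular_size (feasible_cone E q).

Definition convex_vertex E q : Prop := vertex E q /\ interior_angle E q < pi.

(* Local normal cone: it only involves the points of [E] close to [q]. *)
Definition normal_cone E q : set point :=
  [set d | \forall x \near q, E x -> dot d x <= dot d q].

Definition tightness E q : R := angular_size (normal_cone E q).

Definition relatively_open E (N : set point) : Prop :=
  exists2 U, open U & N = E `&` U.

End PolygonalRegions.

(* Main.v *)
(** Near a vertex [p] the frontier of [E] is the union of two rays from [p]
    spanned by independent vectors [u] and [v], because the other edges and the
    other polygons form a closed set avoiding [p]. Connected sets off the
    frontier lie inside or outside [E]; hence if [E] had a point near [p]
    outside the closed sector of [u] and [v], the whole complementary sector
    would lie in [E], and it contains a half-plane of directions, making the
    interior angle at least [pi]. So near a convex vertex [E] lies in the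
    sector, and the normal cone at [p] contains the open cone [d.u < 0],
    [d.v < 0], of positive angular size. At the other nearby points [E] contains
    a small segment through the point, which confines the normal cone to a line,
    so the tightness is zero; and such a point is not a vertex, since there the
    frontier would span two independent directions. *)
Require Import Defs.
From HB Require Import structures.
From mathcomp Require Import all_boot all_order all_algebra.
From mathcomp Require Import all_classical all_reals all_analysis.
From mathcomp Require Import ring lra zify.
Import Order.TTheory GRing.Theory Num.Theory.
Import numFieldNormedType.Exports.
Local Open Scope classical_set_scope.
Local Open Scope ring_scope.

Set Implicit Arguments.
Unset Strict Implicit.

(** * Angular size of sets of directions *)

Section Angles.
Context {R : realType}.
Implicit Types (phi psi a : R) (d u v w : R * R) (A B : set R).

(** The measure unfolds to an outer measure, which is monotone on arbitrary sets; sets of angles can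
    then be compared directly. *)
Lemma le_lebesgue_measure A B : A `<=` B ->
  (lebesgue_measure A <= lebesgue_measure B)%E.
Proof.
move=> AB.
rewrite /lebesgue_measure /lebesgue_stieltjes_measure /measure_extension/=.
exact: le_outer_measure.
Qed.

(** The hypotheses force [cos a = 1], so the half-angle formula gives [sin (a / 2) = 0]; strictly
    between [-pi] and [pi] the sine vanishes only at 0. *)
Lemma sin_cos_eq0 a : - (pi *+ 2) < a < pi *+ 2 -> sin a = 0 -> 0 < cos a ->
  a = 0.
Proof.
move=> /andP[a1 a2] s0 c0.
have c1 : cos a = 1.
  have := cos2Dsin2 a; rewrite s0 => h; nra.
have s2 : sin (a / 2) = 0.
  have := cos_mulr2n (a / 2); have := cos2Dsin2 (a / 2).
  by have -> : a / 2 *+ 2 = a by [field]; rewrite c1 => h h'; nra.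
have [a0|a0|//] := ltgtP a 0.
- have : 0 < sin (- (a / 2)) by apply: sin_gt0_pi; apply/andP; split; lra.
  by rewrite sinN s2 oppr0 ltxx.
- have : 0 < sin (a / 2) by apply: sin_gt0_pi; apply/andP; split; lra.
  by rewrite s2 ltxx.
Qed.

Lemma polar u : u != 0 ->
  exists r a, [/\ 0 < r, 0 <= a < 2 * pi & u = (r * cos a, r * sin a)].
Proof.
case: u => x y u0.
pose r := Num.sqrt (x ^+ 2 + y ^+ 2).
have r0 : 0 < r.
  rewrite sqrtr_gt0 lt_neqAle addr_ge0 ?sqr_ge0// andbT eq_sym.
  by rewrite paddr_eq0 ?sqr_ge0// !sqrf_eq0; exact: u0.
have r2 : r ^+ 2 = x ^+ 2 + y ^+ 2 by rewrite sqr_sqrtr// addr_ge0 ?sqr_ge0.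
have xr : -1 <= x / r <= 1.
  rewrite ler_pdivlMr// ler_pdivrMr//; apply/andP; split; nra.
have cK : cos (acos (x / r)) = x / r by rewrite acosK// in_itv.
have sK : r * sin (acos (x / r)) = `|y|.
  rewrite sin_acos// -{1}(gtr0_norm r0) -sqrtr_sqr -sqrtrM ?sqr_ge0//.
  have -> : r ^+ 2 * (1 - (x / r) ^+ 2) = y ^+ 2.
    by have -> : r ^+ 2 * (1 - (x / r) ^+ 2) = r ^+ 2 - x ^+ 2;
      [field; rewrite gt_eqF|rewrite r2; ring].
  by rewrite sqrtr_sqr.
have [p0 p1] := (acos_ge0 xr, acos_lepi xr).
have pi0 := pi_gt0 R.
have [y0|y0] := leP 0 y.
  exists r, (acos (x / r)); split=> //; first by apply/andP; split; lra.
  by rewrite sK cK ger0_norm// mulrC divfK// gt_eqF.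
(* In the lower half-plane the angle is reflected. It stays below [2 * pi] because
   [acos (x / r) = 0] would give [y = 0]. *)
exists r, (pi *+ 2 - acos (x / r)); split=> //.
  apply/andP; split; first lra.
  suff : 0 < acos (x / r) by lra.
  rewrite lt_neqAle p0 andbT; apply/eqP => h.
  by move: sK; rewrite -h sin0 mulr0 ltr0_norm//; lra.
rewrite cosB sinB cos2pi sin2pi !mul1r !mul0r addr0 sub0r mulrN sK cK.
by rewrite ltr0_norm// opprK mulrC divfK// gt_eqF.
Qed.

Definition angles (C : set (R * R)) : set R :=
  [set phi | 0 <= phi < 2 * pi /\ C (cos phi, sin phi)].

(** [fine] sends an infinite measure to 0, so the angles are first bounded by the interval from 0 to
    [2 * pi]. *)
Lemma le_angular_size (C : set (R * R)) A : A `<=` angles C ->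
  (lebesgue_measure A <= (angular_size C)%:E)%E.
Proof.
move=> AC.
have pi0 := pi_gt0 R.
have lC : (lebesgue_measure (angles C) <= (2 * pi)%:E)%E.
  rewrite (_ : (2 * pi)%:E = lebesgue_measure `[0, 2 * pi : R]%classic).
    apply: le_lebesgue_measure => phi [/andP[h1 h2] _] /=.
    by rewrite in_itv/= h1 ltW.
  by rewrite lebesgue_measure_itv/= lte_fin mulr_gt0// oppr0 adde0.
rewrite /angular_size -/(angles C) fineK ?le_lebesgue_measure//.
rewrite ge0_fin_numE ?(le_lt_trans lC) ?ltry//.
Qed.

(** The line orthogonal to [u] meets the unit circle in two points, told apart by the sign of
    [cross u]; a finite set of angles has measure zero. *)
Lemma angular_size_line u (C : set (R * R)) : u != 0 ->
  (forall d, C d -> dot d u = 0) -> angular_size C = 0.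
Proof.
move=> u0 Cu; rewrite /angular_size -/(angles _).
suff H : finite_set (angles C).
  by rewrite countable_lebesgue_measure0//; exact: finite_set_countable.
pose S (e : R) := angles C `&` [set phi | 0 < e * cross u (cos phi, sin phi)].
have uu : 0 < u.1 ^+ 2 + u.2 ^+ 2.
  rewrite lt_neqAle addr_ge0 ?sqr_ge0// andbT eq_sym.
  by rewrite paddr_eq0 ?sqr_ge0// !sqrf_eq0; case: u u0 {Cu S}.
have S1 (e : R) : is_subset1 (S e).
  move=> phi psi [] [/andP[p0 p1] /Cu hp] /= cp [] [/andP[q0 q1] /Cu hq] /= cq.
  apply/eqP; rewrite -subr_eq0; apply/eqP; move: hp cp hq cq.
  rewrite /dot /cross/= => hp cp hq cq.
  apply: sin_cos_eq0; first by apply/andP; split; lra.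
    rewrite sinB.
    (* [sin (phi - psi)] kills both coordinates of the nonzero vector [u]. *)
    have h1 : (sin phi * cos psi - cos phi * sin psi) * u.1 = 0.
      rewrite -[RHS](mulr0 (sin phi)) -[in RHS]hq.
      rewrite -[RHS]subr0 -(mulr0 (sin psi)) -hp; ring.
    have h2 : (sin phi * cos psi - cos phi * sin psi) * u.2 = 0.
      rewrite -[RHS](mulr0 (cos psi)) -[in RHS]hp.
      rewrite -[RHS]subr0 -(mulr0 (cos phi)) -hq; ring.
    apply/eqP; move/eqP: h1; rewrite mulf_eq0 => /orP[//|/eqP h1].
    move/eqP: h2; rewrite mulf_eq0 => /orP[//|/eqP h2].
    by move: uu; rewrite h1 h2 expr0n addr0 ltxx.
  (* Modulo orthogonality, the product of the two cross products is a positive multiple of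
     [cos (phi - psi)]. *)
  have := mulr_gt0 cp cq.
  have -> : e * (u.1 * sin phi - u.2 * cos phi) *
      (e * (u.1 * sin psi - u.2 * cos psi)) =
      e ^+ 2 * (u.1 ^+ 2 + u.2 ^+ 2) * cos (phi - psi).
    rewrite cosB.
    apply/eqP; rewrite -subr_eq0; apply/eqP.
    transitivity (- e ^+ 2 * ((u.1 * cos psi + u.2 * sin psi) *
      (cos phi * u.1 + sin phi * u.2))); last by rewrite hp !mulr0.
    ring.
  by rewrite pmulr_rgt0// mulr_gt0// exprn_even_gt0//=;
    apply/eqP => e0; rewrite e0 mul0r ltxx in cp.
have finS e : finite_set (S e).
  have [->|/set0P[x Sx]] := eqVneq (S e) set0; first exact: finite_set0.
  by apply: (@sub_finite_set _ _ [set x]) => // y Sy; exact: (S1 e).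
apply: (@sub_finite_set _ _ (S 1 `|` S (-1))); last first.
  by rewrite finite_setU; split.
move=> phi hphi; rewrite /S/=.
have [h|h|h] := ltgtP (cross u (cos phi, sin phi)) 0.
- by right; split=> //; lra.
- by left; split=> //; lra.
(* By Lagrange's identity the squares of the dot and cross products add up to the squared length of
   [u], so they cannot both vanish. *)
- exfalso; have [_ /Cu] := hphi; move: h; rewrite /cross /dot/= => h1 h2.
  have := cos2Dsin2 phi => h3.
  have : u.1 ^+ 2 + u.2 ^+ 2 = 0.
    rewrite -[LHS]mulr1 -h3.
    transitivity ((u.1 * sin phi - u.2 * cos phi) ^+ 2 +
      (cos phi * u.1 + sin phi * u.2) ^+ 2); first ring.
    by rewrite h1 h2; ring.
  by move=> h4; rewrite h4 ltxx in uu.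
Qed.

(** If [w] has angle [a], the half-plane is the arc from [a] to [a + pi]. When [a > pi] it wraps
    past [2 * pi] and splits into two intervals of total length [pi]. *)
Lemma angular_size_halfplane w (C : set (R * R)) : w != 0 ->
  (forall d, cross d w < 0 -> C d) -> pi <= angular_size C.
Proof.
move=> /polar[r [a [r0 /andP[a0 a1] ->]]] H.
have pi0 := pi_gt0 R.
have HC phi : 0 < sin (phi - a) -> C (cos phi, sin phi).
  move=> h; apply: H; rewrite /cross/=.
  rewrite (_ : _ - _ = - (r * sin (phi - a))) ?oppr_lt0 ?mulr_gt0//.
  by rewrite sinB; ring.
have [ap|pa] := leP a pi.
  rewrite -lee_fin (le_trans _ (@le_angular_size _ `]a, (a + pi)[%classic _))//.
    rewrite lebesgue_measure_itv/= lte_fin ltrDl pi0 -EFinD lee_fin; lra.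
  move=> phi; rewrite /= in_itv/= => /andP[h1 h2]; split.
    by apply/andP; split; lra.
  by apply/HC/sin_gt0_pi/andP; split; lra.
rewrite -lee_fin (le_trans _ (@le_angular_size _
  (`[0, (a - pi)[%classic `|` `]a, (2 * pi)[%classic) _))//.
  rewrite measureU//=; last first.
    rewrite -subset0 => phi [/=]; rewrite !in_itv/=.
    by move=> /andP[? ?] /andP[? ?]; lra.
  rewrite !lebesgue_measure_itv/= !lte_fin subr_gt0 pa a1 -!EFinD lee_fin; lra.
move=> phi [] /=; rewrite in_itv/= => /andP[h1 h2]; split.
- by apply/andP; split; lra.
- apply: HC; rewrite -sinD2pi; apply/sin_gt0_pi/andP; split; lra.
- by apply/andP; split; lra.
- by apply: HC; apply/sin_gt0_pi/andP; split; lra.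
Qed.

Lemma angular_size_gt0 u v (C : set (R * R)) : cross u v != 0 ->
  (forall d, dot d u < 0 -> dot d v < 0 -> C d) -> 0 < angular_size C.
Proof.
move=> c0 H.
(* Cramer's rule for [dot w u = dot w v = -1]. *)
pose w : R * R := (- ((v.2 - u.2) / cross u v), - ((u.1 - v.1) / cross u v)).
have wu : dot w u = -1 by move: c0; rewrite /w /dot /cross/= => c0; field.
have wv : dot w v = -1 by move: c0; rewrite /w /dot /cross/= => c0; field.
have w0 : w != 0.
  by apply/eqP => w0; move: wu; rewrite w0 /dot/= !mul0r addr0; lra.
have [r [a [r0 /andP[a0 a1] wE]]] := polar w0.
have cont z : {for a, continuous (fun phi => dot (cos phi, sin phi) z)}.
  apply: cvgD; apply: cvgMr_tmp; [exact: continuous_cos|exact: continuous_sin].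
have neg z : dot w z = -1 -> \forall phi \near a, dot (cos phi, sin phi) z < 0.
  move=> wz; apply: (cvgr_lt _ (cont z)).
  suff : r * dot (cos a, sin a) z < 0 by rewrite pmulr_rlt0.
  rewrite (_ : _ * _ = -1) ?ltrN10// -wz wE /dot/=; ring.
have : \forall phi \near a, phi < 2 * pi /\ C (cos phi, sin phi).
  near=> phi; split; first by near: phi; exact: lt_nbhsl.
  by apply: H; near: phi; exact: neg.
move=> /nbhs_ballP[e /= e0 he].
(* The interval extends to the right only, since [a] may be 0. *)
rewrite -lte_fin (lt_le_trans _ (@le_angular_size _ `[a, (a + e)[%classic _))//.
  by rewrite lebesgue_measure_itv/= lte_fin ltrDl e0 -EFinD lte_fin; lra.
move=> phi; rewrite /= in_itv/= => /andP[h1 h2].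
have [|h3 h4] := he phi; last by split=> //; apply/andP; split=> //; lra.
by rewrite /ball/= ltr_distlC; apply/andP; split; lra.
Unshelve. all: by end_near. Qed.

End Angles.

(** * Segments, connectedness and the frontier near a vertex *)

Section LocalStructure.
Context {R : realType}.
Implicit Types (E : set (R * R)) (a b d p q u v w x y : R * R).
Implicit Types (s : seq (R * R)).

Definition ray p u : set (R * R) :=
  [set x | exists2 t : R, 0 <= t & x = p + t *: u].

Lemma continuous_line a u : continuous (fun t : R => a + t *: u).
Proof.
move=> t; apply: cvgD; first exact: cvg_cst.
exact: cvgZr_tmp cvg_id.
Qed.

Lemma segment_image a b :
  segment a b = (fun t => a + t *: (b - a)) @` `[0, 1].
Proof.
have E t : (1 - t) *: a + t *: b = a + t *: (b - a).
  by rewrite scalerBl scale1r scalerBr addrAC addrA.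
apply/seteqP; split=> [x [t t01 ->]|x [t]].
  by exists t; rewrite ?E //= in_itv.
by rewrite /= in_itv/= => t01 <-; exists t; rewrite ?E.
Qed.

Lemma segmentC a b : segment a b = segment b a.
Proof.
suff S c d : segment c d `<=` segment d c by apply/seteqP; split; exact: S.
move=> x [t /andP[t0 t1] ->]; exists (1 - t); first by apply/andP; split; lra.
by rewrite opprB addrCA subrr addr0 addrC.
Qed.

Lemma segment_start a b : segment a b a.
Proof. by exists 0; rewrite ?lexx ?ler01// subr0 scale1r scale0r addr0. Qed.

Lemma connected_segment a b : connected (segment a b).
Proof.
rewrite segment_image; apply: connected_continuous_connected.
  exact: segment_connected.
exact/continuous_subspaceT/continuous_line.
Qed.

Lemma closed_segment a b : closed (segment a b).
Proof.
rewrite segment_image; apply: compact_closed; first exact: norm_hausdorff.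
apply: continuous_compact; last exact: segment_compact.
exact/continuous_subspaceT/continuous_line.
Qed.

(** Off the frontier [E] agrees with its interior, so its trace on [S] is both open and closed in
    [S]. *)
Lemma connected_off_frontier E (S : set (R * R)) x : closed E -> connected S ->
  (forall z, S z -> ~ frontier E z) -> S x -> E x -> S `<=` E.
Proof.
move=> cE cS SE Sx Ex.
have SI : S `&` interior E = S `&` E.
  apply/seteqP; split=> z [Sz Ez]; split=> //; first exact: interior_subset.
  apply: contrapT => nEz; apply: (SE _ Sz); split=> //.
  exact: subset_closure.
have <- : S `&` E = S; last by move=> z [].
apply: cS.
- by exists x.
- by exists (interior E); [exact: open_interior|].
- by exists E.
Qed.

Lemma near_segment a b : a != b ->
  \forall x \near a, segment a b x <-> ray a (b - a) x.
Proof.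
move=> ab.
have ab0 : 0 < `|b - a| by rewrite normr_gt0 subr_eq0 eq_sym.
apply/nbhs_normP; exists `|b - a| => //= x /= xab.
rewrite segment_image; split=> [[t]|[t t0 xE]].
  by rewrite /= in_itv/= => /andP[t0 t1] <-; exists t.
exists t => //; rewrite /= in_itv/= t0 /=.
move: xab; rewrite xE opprD addNKr normrN normrZ ger0_norm//.
by rewrite -[ltRHS]mul1r ltr_pM2r// => /ltW.
Qed.

Lemma vert_mod s i : vert s (i %% size s) = vert s i.
Proof. by rewrite /vert modn_mod. Qed.

Lemma vertSmod s i : vert s (i %% size s).+1 = vert s i.+1.
Proof. by rewrite /vert -addn1 modnDml addn1. Qed.

Lemma edge_mod s i : edge s (i %% size s) = edge s i.
Proof. by rewrite /edge vert_mod vertSmod. Qed.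

Lemma closed_polygon s : closed (polygon s).
Proof. apply: closed_bigcup => // i _; exact: closed_segment. Qed.

Lemma near_notin (C : set (R * R)) p : closed C -> ~ C p ->
  \forall x \near p, ~ C x.
Proof.
by move=> cC Cp; apply: open_nbhs_nbhs; split=> //; exact: closed_openC.
Qed.

(** Only the two edges ending at [p] contain it, by simplicity; the others form a closed set
    avoiding [p]. Independence of the directions is the corner condition. *)
Lemma near_polygon_vertex s p : simple_closed_polygon s -> p \in s ->
  exists u v, cross u v != 0 /\
    \forall x \near p, polygon s x <-> ray p u x \/ ray p v x.
Proof.
move=> [s3 us adj corner] ps.
set n := size s in s3 adj.
pose i := index p s.
have iN : (i < n)%N by rewrite index_mem.
have vi : vert s i = p by rewrite /vert modn_small// nth_index.
have n0 : (0 < n)%N by lia.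
(* The cyclic predecessor of [i]; adding [n] before subtracting 1 handles [i = 0]. *)
pose k := (i + n).-1.
have kS : k.+1 = (i + n)%N by rewrite prednK// addn_gt0 n0 orbT.
pose j := (k %% n)%N.
have jN : (j < n)%N by rewrite ltn_mod.
have vk : vert s k.+1 = p by rewrite -vi kS /vert modnDr.
have vkS : vert s k.+2 = vert s i.+1 by rewrite kS /vert -addSn modnDr.
have ei : edge s i = segment p (vert s i.+1) by rewrite /edge vi.
have ej : edge s j = segment p (vert s k) by rewrite edge_mod /edge vk segmentC.
have ck := corner k; rewrite vk vkS in ck.
have others m : (m < n)%N -> m <> i -> m <> j -> ~ edge s m p.
  move=> mN mi mj mp.
  have ip : edge s i p by rewrite ei; exact: segment_start.
  have [[_ pm]|[im _]] := adj i m p iN mN (nesym mi) ip mp.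
    apply: mi; apply/eqP; rewrite -(nth_uniq 0 mN iN us); apply/eqP.
    by rewrite [RHS]nth_index// pm /vert modn_small.
  apply: mj; rewrite /j /k im.
  have [mn|mn] := ltnP m.+1 n.
    by rewrite (modn_small mn) addSn/= modnDr modn_small.
  have -> : n = m.+1 by lia.
  by rewrite modnn add0n/= modn_small.
pose rest := \bigcup_(m in `I_n `&` [set m | m <> i /\ m <> j]) edge s m.
have cr : closed rest.
  apply: closed_bigcup => [|m _]; last exact: closed_segment.
  exact/finite_setIl/finite_II.
have nr : ~ rest p by move=> [m [mN [mi mj]]]; exact: others.
exists (vert s i.+1 - p), (vert s k - p); split.
  by apply: contra ck => /eqP c0; rewrite -c0 /cross/=; apply/eqP; ring.
have cross0 x : cross 0 x = 0 by rewrite /cross/= !mul0r subr0.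
have crossx0 x : cross x 0 = 0 by rewrite /cross/= !mulr0 subr0.
have pi1 : p != vert s i.+1.
  by apply: contra ck => /eqP <-; rewrite subrr crossx0.
have pk : p != vert s k by apply: contra ck => /eqP <-; rewrite subrr cross0.
near=> x.
have [ri Ri] : segment p (vert s i.+1) x <-> ray p (vert s i.+1 - p) x.
  by near: x; exact: near_segment.
have [rj Rj] : segment p (vert s k) x <-> ray p (vert s k - p) x.
  by near: x; exact: near_segment.
have nx : ~ rest x by near: x; exact: near_notin.
split=> [[m mN mx]|[/Ri xi|/Rj xj]].
- have [mi|/eqP mi] := eqVneq m i; first by left; apply: ri; rewrite -ei -mi.
  have [mj|/eqP mj] := eqVneq m j; first by right; apply: rj; rewrite -ej -mj.
  by exfalso; apply: nx; exists m.
- by exists i => //; rewrite ei.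
- by exists j => //; rewrite ej.
Unshelve. all: by end_near. Qed.

Lemma near_frontier_vertex E p : vertex E p ->
  exists u v, cross u v != 0 /\
    \forall x \near p, frontier E x <-> ray p u x \/ ray p v x.
Proof.
move=> [P [[finP simP disP frE] [s Ps ps]]].
have [u [v [c0 loc]]] := near_polygon_vertex (simP s Ps) ps.
exists u, v; split=> //.
have sp : polygon s p.
  by apply/(nbhs_singleton loc); left; exists 0; rewrite ?scale0r ?addr0.
pose rest := \bigcup_(r in P `\ s) polygon r.
have nr : ~ rest p.
  move=> [r [Pr rs] rp]; apply: rs; apply: (disP _ _ Pr Ps).
  by exists p.
have cr : closed rest.
  apply: closed_bigcup => [|r _]; last exact: closed_polygon.
  exact: finite_setD.
near=> x.
have <- : polygon s x <-> ray p u x \/ ray p v x by near: x.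
have nx : ~ rest x by near: x; exact: near_notin.
rewrite frE; split=> [[r Pr rx]|sx]; last by exists s.
have [<-//|/eqP rs] := eqVneq r s.
by exfalso; apply: nx; exists r.
Unshelve. all: by end_near. Qed.

(** * Half discs and the sector at a corner *)

Lemma convex_lt (t r1 r2 e : R) : 0 <= t <= 1 -> r1 < e -> r2 < e ->
  (1 - t) * r1 + t * r2 < e.
Proof.
move=> /andP[]; rewrite le_eqVlt => /predU1P[<- _|t0 t1] h1 h2.
  by rewrite subr0 mul1r mul0r addr0.
nra.
Qed.

(** An open half disc is convex, so the segment joining two of its points stays off the frontier. *)
Lemma half_disc_sub E p e w : closed E ->
  (forall x, `|p - x| < e -> cross (x - p) w < 0 -> ~ frontier E x) ->
  forall x y, `|p - x| < e -> cross (x - p) w < 0 ->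
    `|p - y| < e -> cross (y - p) w < 0 -> E x -> E y.
Proof.
move=> cE off x y xe xw ye yw Ex.
suff S : segment x y `<=` E by apply: S; rewrite segmentC; exact: segment_start.
apply: (connected_off_frontier cE (@connected_segment x y) _ _ Ex);
  last exact: segment_start.
move=> z [t t01 ->]; have /andP[t0 t1] := t01; apply: off.
  have -> : p - ((1 - t) *: x + t *: y) = (1 - t) *: (p - x) + t *: (p - y).
    by rewrite !scalerBr addrACA -scalerDl subrK scale1r -opprD.
  rewrite (le_lt_trans (ler_normD _ _))// !normrZ !ger0_norm ?subr_ge0//.
  exact: convex_lt.
have -> : cross ((1 - t) *: x + t *: y - p) w =
    (1 - t) * cross (x - p) w + t * cross (y - p) w.
  by rewrite /cross/= /GRing.scale/=; ring.
exact: convex_lt.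
Qed.

Lemma near_line (P : R * R -> Prop) q u : (\forall x \near q, P x) ->
  \forall t \near (0 : R), P (q + t *: u).
Proof.
move=> Pq; apply: (@continuous_line q u 0).
by rewrite /= scale0r addr0.
Qed.

(** A point outside the sector has a negative coordinate along [u] or along [v]. Each condition cuts
    out a half disc off the frontier, and the two overlap; so one point of [E] in either fills the
    first one, whose directions form a half-plane. *)
Lemma corner_dichotomy E p u v e : closed E -> cross u v != 0 -> 0 < e ->
  (forall x, `|p - x| < e -> frontier E x -> ray p u x \/ ray p v x) ->
  (forall x, `|p - x| < e -> E x -> exists r t, [/\ 0 <= r, 0 <= t &
     x = p + r *: u + t *: v]) \/ pi <= interior_angle E p.
Proof.
move=> cE c0 e0 fr.
pose c := cross u v.
(* Crossing [x - p] with [wu] and [wv] gives its coordinates in the basis [u], [v]. *)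
pose wu := c^-1 *: v; pose wv := - (c^-1 *: u).
have wuE x : cross (x - p) wu = cross (x - p) v / c.
  by rewrite /cross/= /GRing.scale/=; ring.
have wvE x : cross (x - p) wv = cross u (x - p) / c.
  by rewrite /cross/= /GRing.scale/=; ring.
have coord x : x = p + (cross (x - p) wu) *: u + (cross (x - p) wv) *: v.
  rewrite wuE wvE; move: c0; rewrite /c /cross/= => c0.
  rewrite [LHS]surjective_pairing [RHS]surjective_pairing/= /GRing.scale/=.
  by congr (_, _); field.
have rayu t : cross (p + t *: u - p) wu = t /\ cross (p + t *: u - p) wv = 0.
  rewrite wuE wvE; move: c0; rewrite /c /cross/= /GRing.scale/= => c0.
  by split; field.
have rayv t : cross (p + t *: v - p) wu = 0 /\ cross (p + t *: v - p) wv = t.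
  rewrite wuE wvE; move: c0; rewrite /c /cross/= /GRing.scale/= => c0.
  by split; field.
have offu x : `|p - x| < e -> cross (x - p) wu < 0 -> ~ frontier E x.
  move=> xe xw /(fr _ xe)[[t t0 xE]|[t t0 xE]]; move: xw; rewrite xE.
    by rewrite (rayu t).1 ltNge t0.
  by rewrite (rayv t).1 ltxx.
have offv x : `|p - x| < e -> cross (x - p) wv < 0 -> ~ frontier E x.
  move=> xe xw /(fr _ xe)[[t t0 xE]|[t t0 xE]]; move: xw; rewrite xE.
    by rewrite (rayu t).2 ltxx.
  by rewrite (rayv t).2 ltNge t0.
have [[x [xe Ex xw]]|no] := pselect (exists x, [/\ `|p - x| < e, E x &
    cross (x - p) wu < 0 \/ cross (x - p) wv < 0]); last first.
  left=> x xe Ex; exists (cross (x - p) wu), (cross (x - p) wv).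
  by split=> //; rewrite leNgt; apply/negP => h; apply: no; exists x; split;
    auto.
right.
pose r := e / 2 / (1 + `|u + v|).
have uv0 := normr_ge0 (u + v).
have r0 : 0 < r by rewrite divr_gt0 ?divr_gt0// ltr_pwDl.
(* [z] lies in both half discs, so it links any two points of their union. *)
pose z := p - r *: (u + v).
have ze : `|p - z| < e.
  rewrite /z opprB addrCA subrr addr0 normrZ gtr0_norm//.
  have : r * (1 + `|u + v|) = e / 2 by rewrite /r divfK// gt_eqF// ltr_pwDl.
  nra.
have zu : cross (z - p) wu < 0.
  rewrite (_ : cross _ _ = - r) ?oppr_lt0// wuE /z.
  by move: c0; rewrite /c /cross/= /GRing.scale/= => c0; field.
have zv : cross (z - p) wv < 0.
  rewrite (_ : cross _ _ = - r) ?oppr_lt0// wvE /z.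
  by move: c0; rewrite /c /cross/= /GRing.scale/= => c0; field.
have Ez : E z.
  by case: xw => xw; [exact: (half_disc_sub cE offu xe)|
    exact: (half_disc_sub cE offv xe)].
have wu0 : wu != 0.
  by apply/eqP => w0; move: zu; rewrite w0 /cross/= !mulr0 subr0 ltxx.
apply: (angular_size_halfplane wu0) => d dw.
have nbt : \forall t \near 0^'+, `|p - (p + t *: d)| < e.
  apply: cvg_within; apply: (@near_line (fun x => `|p - x| < e)).
  by apply/nbhs_normP; exists e.
near=> t.
have t0 : 0 < t by [].
apply: (half_disc_sub cE offu ze zu) => //; first by near: t.
rewrite (_ : cross _ _ = t * cross d wu) ?pmulr_rlt0//.
by rewrite /cross/= /GRing.scale/=; ring.
Unshelve. all: by end_near. Qed.

(** * Tightness at a corner and at nearby points *)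

Lemma tightness_gt0 E p u v : cross u v != 0 ->
  (\forall x \near p, E x -> exists r t, [/\ 0 <= r, 0 <= t &
     x = p + r *: u + t *: v]) -> 0 < tightness E p.
Proof.
move=> c0 En; apply: (angular_size_gt0 c0) => d du dv.
apply: filterS En => x Ex /Ex[r [t [r0 t0 ->]]].
have -> : dot d (p + r *: u + t *: v) = dot d p + (r * dot d u + t * dot d v).
  by rewrite /dot/= /GRing.scale/=; ring.
by rewrite gerDl; nra.
Qed.

Lemma near0_pm (P : R -> Prop) : (\forall t \near (0 : R), P t) ->
  exists2 t, 0 < t & P t /\ P (- t).
Proof.
move=> /nbhs_normP[e /= e0 eP]; exists (e / 2); first by rewrite divr_gt0.
by split; apply: eP; rewrite /= sub0r ?normrN gtr0_norm ?divr_gt0//; lra.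
Qed.

(** Moving from [q] both ways along [u] shows that every normal direction is orthogonal to [u]. *)
Lemma tightness_eq0 E q u : u != 0 ->
  (\forall t \near (0 : R), E (q + t *: u)) -> tightness E q = 0.
Proof.
move=> u0 Eq; apply: (angular_size_line u0) => d dn.
have : \forall t \near (0 : R), t * dot d u <= 0.
  near=> t.
  have Et : E (q + t *: u) by near: t.
  have : E (q + t *: u) -> dot d (q + t *: u) <= dot d q.
    by near: t; exact: (near_line u dn).
  move=> /(_ Et).
  have -> : dot d (q + t *: u) = dot d q + t * dot d u.
    by rewrite /dot/= /GRing.scale/=; ring.
  by rewrite gerDl.
move=> /near0_pm[t t0 [h1 h2]].
nra.
Unshelve. all: by end_near. Qed.

Lemma ray_interior E p u v q t : cross u v != 0 -> closed E ->
  (\forall x \near q, frontier E x <-> ray p u x \/ ray p v x) ->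
  0 < t -> q = p + t *: u -> tightness E q = 0 /\ ~ vertex E q.
Proof.
move=> c0 cE loc t0 qE.
have u0 : u != 0.
  by apply/eqP => u0; move: c0; rewrite u0 /cross/= !mul0r subrr eqxx.
have frS : frontier E `<=` E.
  by move=> x []; rewrite -(closure_id E).1.
split.
  apply: (tightness_eq0 u0).
  near=> r; apply: frS.
  have [_ H] : frontier E (q + r *: u) <->
    ray p u (q + r *: u) \/ ray p v (q + r *: u).
    by near: r; exact: (near_line u loc).
  apply: H; left; exists (t + r); last by rewrite qE scalerDl addrA.
  rewrite -[t]opprK addrC subr_ge0; apply: ltW; near: r; apply: lt_nbhsr.
  by rewrite oppr_lt0.
move=> vq; have [u' [v' [c' loc']]] := near_frontier_vertex vq.
have par w : (forall x, ray q w x -> ray q u' x \/ ray q v' x) -> cross w u = 0.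
  move=> hw.
  have off : \forall r \near (0 : R), ~ ray p v (q + r *: w).
    have : \forall r \near (0 : R), t * cross u v + r * cross w v != 0.
      have : (fun r : R => t * cross u v + r * cross w v) r @[r --> 0] -->
          t * cross u v + 0 * cross w v.
        by apply: cvgD; [exact: cvg_cst|apply: cvgMr_tmp; exact: cvg_id].
      move/cvgr_neq0; apply.
      by rewrite mul0r addr0 mulf_neq0// gt_eqF.
    apply: filterS => r /eqP h [k _ kE]; apply: h.
    transitivity (cross (q + r *: w - p) v).
      by rewrite qE /cross/= /GRing.scale/=; ring.
    by rewrite kE /cross/= /GRing.scale/=; ring.
  have [r r0 [[[h1 h2] h3] _]] :=
    near0_pm (filterI (filterI (near_line w loc) (near_line w loc')) off).
  have /h2.2/h1.1[[k k0 kE]|/h3//] :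
      ray q u' (q + r *: w) \/ ray q v' (q + r *: w).
    by apply: hw; exists r => //; exact: ltW.
  apply: (mulfI (lt0r_neq0 r0)); rewrite mulr0.
  transitivity (cross (q + r *: w - p) u).
    by rewrite qE /cross/= /GRing.scale/=; ring.
  by rewrite kE /cross/= /GRing.scale/=; ring.
have /par hu : forall x, ray q u' x -> ray q u' x \/ ray q v' x by left.
have /par hv : forall x, ray q v' x -> ray q u' x \/ ray q v' x by right.
have z1 : cross u' v' * u.1 = 0.
  transitivity (cross u' u * v'.1 - cross v' u * u'.1); last first.
    by rewrite hu hv !mul0r subrr.
  by rewrite /cross; ring.
have z2 : cross u' v' * u.2 = 0.
  transitivity (cross u' u * v'.2 - cross v' u * u'.2); last first.
    by rewrite hu hv !mul0r subrr.
  by rewrite /cross; ring.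
move: c0; rewrite /cross.
have -> : u.1 = 0 by apply: (mulfI c'); rewrite mulr0.
have -> : u.2 = 0 by apply: (mulfI c'); rewrite mulr0.
by rewrite !mul0r subrr eqxx.
Unshelve. all: by end_near. Qed.

End LocalStructure.

Theorem theorem3p1 (R : realType) (E : set (R * R)) (p : R * R)
    (polyE : connected_polygonal_region E) (bdp : frontier E p)
    (cvxp : convex_vertex E p) :
  exists N : set (R * R),
    [/\ relatively_open E N,
        N p,
        forall q, N q -> convex_vertex E q -> q = p
      & forall q, N q -> q <> p -> tightness E q < tightness E p].
Proof.
have [compE _ _ _ _] := polyE.
have cE : closed E by apply: compact_closed => //; exact: norm_hausdorff.
have Ep : E p by have [] := bdp; rewrite -(closure_id E).1.
have [vp ap] := cvxp.
have [u [v [c0 /nbhs_normP[e /= e0 loc]]]] := near_frontier_vertex vp.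
have nbU q : `|p - q| < e ->
    \forall x \near q, frontier E x <-> ray p u x \/ ray p v x.
  move=> qe; apply/nbhs_normP; exists (e - `|p - q|) => /=.
    by rewrite subr_gt0.
  move=> x /= qx; apply: loc => /=.
  have -> : p - x = (p - q) + (q - x) by rewrite addrA subrK.
  by rewrite (le_lt_trans (ler_normD _ _))// -ltrBrDl.
have tp : 0 < tightness E p.
  apply: (tightness_gt0 c0); apply/nbhs_normP; exists e => //= x /= xe.
  have [|quad|/le_lt_trans/(_ ap)] := @corner_dichotomy _ E p u v e cE c0 e0.
  - by move=> y ye /(loc y ye).
  - exact: quad.
  - by rewrite ltxx.
have away q : `|p - q| < e -> E q -> q <> p ->
    tightness E q = 0 /\ ~ vertex E q.
  move=> qe Eq qp; have loq := nbU _ qe.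
  have [qi|qi] := pselect (interior E q).
    split.
      apply: (@tightness_eq0 _ E q (1, 0)).
        by apply/eqP => -[] /eqP; rewrite oner_eq0.
      exact: near_line.
    move=> /near_frontier_vertex[u' [v' [_ /nbhs_singleton [_ H]]]].
    suff : frontier E q by move=> [].
    by apply: H; left; exists 0; rewrite ?scale0r ?addr0.
  have : frontier E q by split=> //; exact: subset_closure.
  have pos (t : R) w : 0 <= t -> q = p + t *: w -> 0 < t.
    rewrite le_eqVlt => /predU1P[<-|//] qE.
    by case: qp; rewrite qE scale0r addr0.
  move=> /(loc q qe)[[t t0 qE]|[t t0 qE]].
    exact: (ray_interior c0 cE loq (pos _ _ t0 qE) qE).
  apply: (ray_interior (u := v) (v := u) _ cE _ (pos _ _ t0 qE) qE).
    apply: contra c0 => /eqP c0; rewrite -oppr_eq0 -c0 /cross.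
    by apply/eqP; ring.
  by apply: filterS loq => x; rewrite or_comm.
exists (E `&` ball_ Num.norm p e); split.
- exists (ball_ Num.norm p e) => //.
  by rewrite ball_normE; exact: ball_open.
- by split=> //=; rewrite subrr normr0.
- move=> q [Eq qe] [vq _]; apply: contrapT => qp.
  by have [_] := away q qe Eq qp.
- by move=> q [Eq qe] qp; rewrite (away q qe Eq qp).1.
Qed.
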